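(* Fix an affine coordinate on $\mathbb P^1$ and the lifts $v_i=(1,\lambda_i)^t$ of eight points, so that $[ij]:=\det(v_i,v_j)=\lambda_j-\lambda_i$; the monic quartics $b_1(t)=\prod_{j=1}^4(t-\lambda_j)$ and $b_2(t)=\prod_{j=5}^8(t-\lambda_j)$; and the marking $\mathfrak d_0$ given by $S_0=\{1,2,3,4\}$, $S_\infty=\{5,6,7,8\}$ with pairings $(12)(34)$ and $(56)(78)$. The two-neighbor and relative-Jacobian construction (described in the context) defines a polynomial map $$(\lambda_1,\dots,\lambda_8)\longmapsto(F_4,G_8,H_8,G_{12},H_{12},H_{16}).$$ With $\deg(\lambda_i)=1$, their ordinary total degrees are $$\begin{array}{c|cccccc}\text{coefficient}&F_4&G_8&H_8&G_{12}&H_{12}&H_{16}\\ \hline \deg_\lambda&4&8&8&12&12&16\end{array}$$ In particular, for $\tau_0=(12)(34)(56)(78)$ and $\mu_{\tau_0}=[12][34][56][78]$ one has $$H_8=-\tfrac14[12]^2[34]^2[56]^2[78]^2=-\tfrac14\mu_{\tau_0}^2,$$ and one can choose $H_4=\mu_{\tau_0}/2$ (where $H_8=-H_4^2$) on the cover $\widetilde{\mathcal M}_{\mathrm K}^{H_4}$.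
   Context: Construction. Step 1: put $Q(t,u)=b_1(t)+u^2b_2(t)$, a quartic in $t$. For a quartic $A_0t^4+A_1t^3+A_2t^2+A_3t+A_4$ let $$\mathcal I=12A_0A_4-3A_1A_3+A_2^2,\quad \mathcal J=72A_0A_2A_4+9A_1A_2A_3-27A_0A_3^2-27A_1^2A_4-2A_2^3.$$ Write $\mathcal I(Q)=I_0+I_2u^2+I_4u^4$, $\mathcal J(Q)=J_0+J_2u^2+J_4u^4+J_6u^6$, and $a_{2j}=-I_{2j}/3$, $b_{2j}=-J_{2j}/27$. The relative Jacobian of $v^2=uQ(t,u)$ over the $u$-line is $$y^2=x^3+u^2(a_0+a_2u^2+a_4u^4)x+u^3(b_0+b_2u^2+b_4u^4+b_6u^6).$$ Step 2 (two-neighbor): let $e_2(S)=\sum_{i<j;\,i,j\in S}\lambda_i\lambda_j$ and $$\alpha=\tfrac13e_2(\{1,2,3,4\})-(\lambda_1\lambda_2+\lambda_3\lambda_4),\qquad \beta=\tfrac13e_2(\{5,6,7,8\})-(\lambda_5\lambda_6+\lambda_7\lambda_8),$$ the roots of $z^3+a_0z+b_0$ and $z^3+a_4z+b_6$ selected by the marking. Substituting $x=u(\alpha+su+\beta u^2)$, $y=u^2w$ gives a genus-one fibration over the $s$-line, $w^2=$ a quartic in $u$ with coefficients polynomial in $s$. Step 3: the relative Jacobian of this quartic, $y^2=x^3-\frac13\widetilde{\mathcal I}(s)x-\frac1{27}\widetilde{\mathcal J}(s)$ (where, writing the quartic in $u$ as $A_0(s)u^4+A_1(s)u^3+A_2(s)u^2+A_3(s)u+A_4(s)$,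 one sets $\widetilde{\mathcal I}=12A_0A_4-3A_1A_3+A_2^2$ and $\widetilde{\mathcal J}=72A_0A_2A_4+9A_1A_2A_3-27A_0A_3^2-27A_1^2A_4-2A_2^3$), is identified, after a translation of $x$ by a polynomial in $s$, with $$y^2=x^3+(s^3+sF_4)x^2+(s^2G_8+G_{12})x+H_8s^5+H_{12}s^3+H_{16}s,$$ the Gaussian (order-four automorphism) restriction of the normal form of $U\oplus D_8(-1)$-polarized K3 surfaces; this determines $F_4,G_8,H_8,G_{12},H_{12},H_{16}$. Covers: $\mathcal M_{\mathrm K}^{\mathrm{ord}}=M_{0,8}$ is the space of ordered eight-tuples of distinct points of $\mathbb P^1$ modulo $\operatorname{PGL}_2$, with its $S_8$-action. $H_{\mathfrak d_0}\subset S_8$ is the stabilizer of $\mathfrak d_0$ (the ordered decomposition $S_0\sqcup S_\infty$ together with the two pairings), $\varepsilon_{\tau_0}:H_{\mathfrak d_0}\to\{\pm1\}$ is the character by which it acts on $\mu_{\tau_0}$, $\widetilde{\mathcal M}_{\mathrm K}=\mathcal M_{\mathrm K}^{\mathrm{ord}}/H_{\mathfrak d_0}$, and $\widetilde{\mathcal M}_{\mathrm K}^{H_4}=\mathcal M_{\mathrm K}^{\mathrm{ord}}/\ker(\varepsilon_{\tau_0})$, a twofold cover of $\widetilde{\mathcal M}_{\mathrm K}$. *)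

(* Defs.v *)
From mathcomp Require Import all_boot all_order all_algebra all_fingroup.
From mathcomp Require Export mpoly.

Set Implicit Arguments.
Unset Strict Implicit.
Unset Printing Implicit Defensive.

Import GRing.Theory Num.Theory.
Local Open Scope ring_scope.

(* The points are labelled 1, ..., 8; the label k is the element k - 1 of 'I_8. *)
Definition pt (k : nat) : 'I_8 := inZp k.-1.

Definition S_zero : {set 'I_8} := [set pt 1; pt 2; pt 3; pt 4].
Definition S_infty : {set 'I_8} := [set pt 5; pt 6; pt 7; pt 8].

Definition pairing_zero : {set {set 'I_8}} :=
  [set [set pt 1; pt 2]; [set pt 3; pt 4]].
Definition pairing_infty : {set {set 'I_8}} :=
  [set [set pt 5; pt 6]; [set pt 7; pt 8]].

Lemma det_mx2 (R : comNzRingType) (M : 'M[R]_2) :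
  \det M = M 0 0 * M 1 1 - M 0 1 * M 1 0.
Proof.
rewrite (expand_det_row _ 0) big_ord_recl big_ord1 /cofactor !det_mx11 !mxE /=.
rewrite expr0 expr1 mul1r mulN1r mulrN.
by congr (M _ _ * M _ _ - M _ _ * M _ _); apply/val_inj.
Qed.

Definition affine_lift (R : comNzRingType) (lam : 'I_8 -> R) (i : 'I_8) :
    'cV[R]_2 :=
  \col_k (if k == 0 then 1 else lam i).

Definition bracket (R : comNzRingType) (v : 'I_8 -> 'cV[R]_2) (i j : 'I_8) : R :=
  \det (row_mx (v i) (v j)).

Lemma bracketE (R : comNzRingType) (v : 'I_8 -> 'cV[R]_2) i j :
  bracket v i j = v i 0 0 * v j 1 0 - v j 0 0 * v i 1 0.
Proof.
have r0 (x y : 'cV[R]_2) k : row_mx x y k (0 : 'I_2) = x k 0.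
  by rewrite -(row_mxEl x y k 0); congr (row_mx x y k _); apply/val_inj.
have r1 (x y : 'cV[R]_2) k : row_mx x y k (1 : 'I_2) = y k 0.
  by rewrite -(row_mxEr x y k 0); congr (row_mx x y k _); apply/val_inj.
by rewrite /bracket det_mx2 !r0 !r1 [v j 0 0 * _]mulrC [v i 1 0 * _]mulrC.
Qed.

(* mu_{tau_0} for tau_0 = (12)(34)(56)(78). *)
Definition mu (R : comNzRingType) (v : 'I_8 -> 'cV[R]_2) : R :=
  bracket v (pt 1) (pt 2) * bracket v (pt 3) (pt 4) *
  bracket v (pt 5) (pt 6) * bracket v (pt 7) (pt 8).

(* The lifts (1, lambda_i) of the universal eight-tuple: lambda_i is 'X_i. *)
Definition universal_lift (C : comNzRingType) : 'I_8 -> 'cV[{mpoly C[8]}]_2 :=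
  affine_lift (fun i => 'X_i).

(* A quartic A_0 t^4 + A_1 t^3 + A_2 t^2 + A_3 t + A_4 is a polynomial q in t of
   size at most 5; the coefficients are numbered from the top: A_k = q`_(4 - k). *)
Section QuarticInvariants.
Variables (R : comNzRingType) (q : {poly R}).
Let A (k : nat) : R := q`_(4 - k).

Definition quartic_I : R :=
  12%:R * A 0 * A 4 - 3%:R * A 1 * A 3 + A 2 ^+ 2.

Definition quartic_J : R :=
  72%:R * A 0 * A 2 * A 4 + 9%:R * A 1 * A 2 * A 3
  - 27%:R * A 0 * A 3 ^+ 2 - 27%:R * A 1 ^+ 2 * A 4 - 2%:R * A 2 ^+ 3.

End QuarticInvariants.

Section Construction.
Variables (C : fieldType) (lam : 'I_8 -> C).

Definition b1 : {poly C} := \prod_(j in S_zero) ('X - (lam j)%:P).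
Definition b2 : {poly C} := \prod_(j in S_infty) ('X - (lam j)%:P).

(* Q(t,u), as a polynomial in t with coefficients in C[u]. *)
Definition Q_tu : {poly {poly C}} :=
  map_poly polyC b1 + ('X^2)%:P * map_poly polyC b2.

Definition a_coef (k : nat) : C := - (quartic_I Q_tu)`_k / 3%:R.
Definition b_coef (k : nat) : C := - (quartic_J Q_tu)`_k / 27%:R.

(* The relative Jacobian of v^2 = u Q(t,u) is y^2 = x^3 + jac_A x + jac_B. *)
Definition jac_A : {poly C} :=
  'X^2 * ((a_coef 0)%:P + (a_coef 2)%:P * 'X^2 + (a_coef 4)%:P * 'X^4).
Definition jac_B : {poly C} :=
  'X^3 * ((b_coef 0)%:P + (b_coef 2)%:P * 'X^2 + (b_coef 4)%:P * 'X^4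
          + (b_coef 6)%:P * 'X^6).

Definition e2 (S : {set 'I_8}) : C :=
  \sum_(i in S) \sum_(j in S | (i < j)%N) lam i * lam j.

Definition alpha : C :=
  e2 S_zero / 3%:R - (lam (pt 1) * lam (pt 2) + lam (pt 3) * lam (pt 4)).
Definition beta : C :=
  e2 S_infty / 3%:R - (lam (pt 5) * lam (pt 6) + lam (pt 7) * lam (pt 8)).

(* u (alpha + s u + beta u^2), as a polynomial in u with coefficients in C[s]. *)
Definition x_subst : {poly {poly C}} :=
  'X * (alpha%:P%:P + ('X)%:P * 'X + beta%:P%:P * 'X^2).

(* w^2 = q is the genus-one fibration over the s-line obtained by substituting
   x = x_subst, y = u^2 w; q is a quartic in u with coefficients in C[s], and
   map_poly polyC views a polynomial in u over C as one over C[s]. *)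
Definition two_neighbor_quartic (q : {poly {poly C}}) : Prop :=
  (size q <= 5)%N /\
  ('X^2) ^+ 2 * q = x_subst ^+ 3 + map_poly polyC jac_A * x_subst
                    + map_poly polyC jac_B.

(* Right-hand side, in (C[s])[x], of the relative Jacobian of w^2 = q. *)
Definition relative_jacobian (q : {poly {poly C}}) : {poly {poly C}} :=
  'X^3 - ((3%:R)^-1 *: quartic_I q)%:P * 'X - ((27%:R)^-1 *: quartic_J q)%:P.

Definition gaussian_normal_form (F4 G8 H8 G12 H12 H16 : C) : {poly {poly C}} :=
  'X^3 + ('X^3 + F4%:P * 'X)%:P * 'X^2
  + (G8%:P * 'X^2 + G12%:P)%:P * 'X
  + (H8%:P * 'X^5 + H12%:P * 'X^3 + H16%:P * 'X)%:P.

Definition gaussian_coefficients (F4 G8 H8 G12 H12 H16 : C) : Prop :=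
  exists (q : {poly {poly C}}) (T : {poly C}),
    two_neighbor_quartic q /\
    relative_jacobian q \Po ('X + T%:P)
      = gaussian_normal_form F4 G8 H8 G12 H12 H16.

End Construction.

(* The stabilizer of the decomposition S_zero, S_infty with its two pairings. *)
Definition H_d0 : {set 'S_8} :=
  [set s : 'S_8 | [&& s @: S_zero == S_zero, s @: S_infty == S_infty,
     [set s @: (p : {set 'I_8}) | p in pairing_zero] == pairing_zero &
     [set s @: (p : {set 'I_8}) | p in pairing_infty] == pairing_infty]].

(* Elements of H_d0 send mu to mu or - mu; the kernel of the resulting character
   consists of those fixing mu. *)
Definition ker_eps (C : comNzRingType) : {set 'S_8} :=
  [set s in H_d0 | msym s (mu (universal_lift C)) == mu (universal_lift C)].

(* Eight-tuples of points of P^1 are given by lifts v to C^2.  For a group G of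
   permutations, two tuples of distinct points define the same point of
   M_{0,8} / G when they agree up to PGL_2, a permutation in G and the choice of
   lifts. *)
Definition distinct_points (C : fieldType) (v : 'I_8 -> 'cV[C]_2) : Prop :=
  forall i j, i != j -> bracket v i j != 0.

Definition same_moduli_point (C : fieldType) (G : {set 'S_8})
    (v w : 'I_8 -> 'cV[C]_2) : Prop :=
  exists (s : 'S_8) (g : 'M[C]_2) (c : 'I_8 -> C),
    [/\ s \in G, g \in unitmx, (forall i, c i != 0) &
        forall i, w i = c i *: (g *m v (s i))].

(* Equality of points of the weighted projective space with weights w. *)
Definition same_weighted_point (C : fieldType) (w : seq nat) (x y : seq C) : Prop :=
  exists2 r : C, r != 0 &
    forall k, (k < size w)%N -> y`_k = r ^+ nth 0%N w k * x`_k.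

Definition total_degree (C : nzRingType) (d : nat) (p : {mpoly C[8]}) : Prop :=
  p \is d.-homog /\ msize p = d.+1.

(* Every point of M_{0,8} has a representative with all eight points finite, so
   maps on its quotients may be described on affine lifts. *)
Lemma affine_representative (C : numFieldType) (v : 'I_8 -> 'cV[C]_2) :
  distinct_points v ->
  exists lam : 'I_8 -> C, same_moduli_point [set 1%g] v (affine_lift lam).
Proof.
move=> dv.
have v_nz i : (v i 0 0 != 0) || (v i 1 0 != 0).
  have [j neq_ij] : exists j, i != j.
    by have [->|] := eqVneq i (pt 1); [exists (pt 2) | exists (pt 1)].
  apply/contraT; rewrite negb_or !negbK => /andP[/eqP v0 /eqP v1].
  have vi0 : v i = 0.
    apply/colP=> k; rewrite mxE.
    by case: (unliftP 0 k) => [l|] -> //; rewrite ord1 (_ : lift 0 0 = 1) //; apply/val_inj.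
  by have/eqP[] := dv _ _ neq_ij; rewrite bracketE vi0 !mxE mul0r mulr0 subr0.
pose P : {poly C} := \prod_i ((v i 0 0)%:P + (v i 1 0)%:P * 'X).
have P_nz : P != 0.
  rewrite /P prodf_seq_neq0; apply/allP=> i _ /=.
  apply/contraT; rewrite negbK => /eqP E.
  have := congr1 (fun p : {poly C} => p`_0) E.
  have := congr1 (fun p : {poly C} => p`_1) E.
  rewrite !coefD !coefC !coefMX !coefC /= add0r addr0 => e1 e0.
  by have := v_nz i; rewrite e1 e0 eqxx.
have [k Pk] : exists k : C, P.[k] != 0.
  pose rs : seq C := [seq m%:R | m <- iota 0 (size P)].
  have [/allP H|/allPn[k _ Pk]] := boolP (all (root P) rs); last by exists k.
  have := @max_poly_roots _ P rs P_nz (introT allP H).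
  rewrite map_inj_uniq ?iota_uniq; last by move=> m n /eqP; rewrite eqr_nat => /eqP.
  by move/(_ isT); rewrite size_map size_iota ltnn.
have f_nz i : v i 0 0 + v i 1 0 * k != 0.
  move: Pk; rewrite /P horner_prod prodf_seq_neq0 => /allP/(_ i (mem_index_enum i)).
  by rewrite /= !hornerE.
exists (fun i => (v i 0 0 + v i 1 0 * k)^-1 * v i 1 0).
exists 1%g, (\matrix_(a, b) (if a == b then 1 else if a == 0 then k else 0)),
  (fun i => (v i 0 0 + v i 1 0 * k)^-1).
split=> [||i|i]; first by rewrite inE.
- rewrite unitmxE det_mx2 !mxE /= mul1r mulr0 subr0.
  exact: unitr1.
- by rewrite invr_neq0.
apply/colP=> a; rewrite !mxE perm1 !big_ord_recl big_ord0 !mxE addr0.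
have -> : lift ord0 ord0 = 1 :> 'I_2 by apply/val_inj.
case: (unliftP 0 a) => [b|] -> /=; last by rewrite mul1r [k * _]mulrC mulVf.
rewrite ord1; have -> : lift 0 0 = 1 :> 'I_2 by apply/val_inj.
by rewrite /= mul0r add0r mul1r.
Qed.

(* Main.v *)
Require Import Defs.
From mathcomp Require Import all_boot all_order all_algebra all_fingroup.
From mathcomp Require Import ring.
Import GRing.Theory Num.Theory.
Local Open Scope ring_scope.
Set Implicit Arguments.
Unset Strict Implicit.
Unset Printing Implicit Defensive.

(** Substituting [x = u (alpha + s u + beta u^2)] in the relative Jacobian
    [y^2 = x^3 + jac_A x + jac_B] gives [u^3] times a polynomial in [u] whose
    constant and leading coefficients are the values at [alpha] and [beta] of
    the resolvent cubics of [b1] and [b2].  They vanish ([resolvent_root]), so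
    what remains after division by [u^4] is a quartic in [u], unique and
    explicit ([two_neighbor_quarticE]).  The translation [T] of its relative
    Jacobian is then forced by the coefficient of [x^2], namely
    [3 T = s^3 + F4 s], and the other coefficients amount to two polynomial
    identities in [s] between the invariants of the quartic
    ([fibre_jacobian_linear], [fibre_jacobian_constant]).  This gives the six
    coefficients as explicit weighted-homogeneous polynomials [normal_form] in
    [alpha], [beta] and the [a_coef], [b_coef] ([gaussian_coefficientsE]).

    Those data are in turn polynomials in the lambdas: the [a_coef] and [b_coef]
    are, up to scalars, the polarizations of the quartic invariants I and J at
    [(b1, b2)], and [alpha], [beta] are combinations of brackets.  The
    coefficients are therefore values of polynomials, homogeneous of the stated
    degrees, and nonzero since all six are nonzero at one explicit
    configuration.  Up to the factor -1/4, H8 is a product of two terms, each of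
    which is the squared difference of the two roots of a resolvent cubic that
    the marking does not select, that is [12]^2 [34]^2 or [56]^2 [78]^2
    ([resolvent_discriminant]).

    For the cover: under a projective change of the lambdas, with matrix of
    determinant [delta] and rescalings [c i] of the lifts, put
    [p = delta^2 c1 c2 c3 c4] and [q = delta^2 c5 c6 c7 c8].  Since I and J are
    invariants of binary quartics, each datum is multiplied by a monomial in [p]
    and [q], and the normal form is such that its entry of degree [4 w] is
    multiplied by [(p q)^w] ([invariants_covariant]).  The function mu is
    multiplied by [p q], so a fourth root of [p q] is the required weighted
    scaling.  A permutation preserving the marking fixes [b1], [b2], [alpha],
    [beta], hence the six coefficients ([invariants_H_d0]), and by definition the
    kernel of the character fixes mu. *)

(** * Quartics, their invariants and resolvents *)

Lemma quartic_IE (R : comNzRingType) (q : {poly R}) :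
  quartic_I q = 12%:R * q`_4 * q`_0 - 3%:R * q`_3 * q`_1 + q`_2 ^+ 2.
Proof. by []. Qed.

Lemma quartic_JE (R : comNzRingType) (q : {poly R}) :
  quartic_J q = 72%:R * q`_4 * q`_2 * q`_0 + 9%:R * q`_3 * q`_2 * q`_1
    - 27%:R * q`_4 * q`_1 ^+ 2 - 27%:R * q`_3 ^+ 2 * q`_0 - 2%:R * q`_2 ^+ 3.
Proof. by []. Qed.

(** The component of bidegree (1, 1) of [I (p + q)]. *)
Definition polar_I (R : comNzRingType) (p q : {poly R}) : R :=
  quartic_I (p + q) - quartic_I p - quartic_I q.

(** Twice the component of bidegree (2, 1) of [J (p + q)]: in the difference
    [J (p + q) - J (p - q)] only the terms of odd degree in [q] survive.  Keeping
    the factor 2 avoids a division.  Written as a combination of values of J, the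
    polarization inherits what holds for J and is compatible with sums. *)
Definition polar_J2 (R : comNzRingType) (p q : {poly R}) : R :=
  quartic_J (p + q) - quartic_J (p - q) - 2%:R * quartic_J q.

Lemma polar_J2E (R : comNzRingType) (p q : {poly R}) :
  polar_J2 p q = 2%:R *
    (72%:R * (q`_4 * p`_2 * p`_0 + p`_4 * q`_2 * p`_0 + p`_4 * p`_2 * q`_0)
     + 9%:R * (q`_3 * p`_2 * p`_1 + p`_3 * q`_2 * p`_1 + p`_3 * p`_2 * q`_1)
     - 27%:R * (q`_4 * p`_1 ^+ 2 + 2%:R * p`_4 * p`_1 * q`_1)
     - 27%:R * (q`_0 * p`_3 ^+ 2 + 2%:R * p`_0 * p`_3 * q`_3)
     - 6%:R * p`_2 ^+ 2 * q`_2).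
Proof. rewrite /polar_J2 !quartic_JE !(coefD, coefN); ring. Qed.

Definition quartic (R : comNzRingType) (x y z t : R) : {poly R} :=
  ('X - x%:P) * ('X - y%:P) * ('X - z%:P) * ('X - t%:P).

Lemma quarticE (R : comNzRingType) (x y z t : R) :
  quartic x y z t = Poly [:: x * y * z * t;
    - (x * y * z + x * y * t + x * z * t + y * z * t);
    x * y + x * z + x * t + y * z + y * t + z * t; - (x + y + z + t); 1].
Proof. rewrite /quartic /= !cons_poly_def mul0r; ring. Qed.

(** Three times the root of the resolvent cubic attached to the pairing
    (x y)(z t); on the two blocks it is [3 alpha] and [3 beta]. *)
Definition resolvent (R : comNzRingType) (x y z t : R) : R :=
  x * z + x * t + y * z + y * t - 2%:R * (x * y + z * t).

(** With [r = 3 z], [a = - I / 3] and [b = - J / 27] this is 27 times the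
    equation [z^3 + a z + b = 0]. *)
Lemma resolvent_root (R : comNzRingType) (x y z t : R) (q := quartic x y z t) :
  resolvent x y z t ^+ 3 - 3%:R * quartic_I q * resolvent x y z t
    - quartic_J q = 0.
Proof.
rewrite /q quartic_IE quartic_JE quarticE !coef_Poly /= /resolvent; ring.
Qed.

(** Both sides are three times the discriminant of the quadratic factor left when
    the selected root is removed from the resolvent cubic: its two roots,
    attached to the other two pairings, differ by the product of the brackets of
    the selected pairing. *)
Lemma resolvent_discriminant (R : comNzRingType) (x y z t : R) :
  4%:R * quartic_I (quartic x y z t) - resolvent x y z t ^+ 2
    = 3%:R * ((y - x) * (t - z)) ^+ 2.
Proof. rewrite quartic_IE quarticE !coef_Poly /= /resolvent; ring. Qed.

(** * The explicit normal form *)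

(** The parameters stand for [x = alpha / 2], [y = beta / 2] and the coefficients
    [a_coef], [b_coef]; the halves make all formulas integral, so that they make
    sense in a polynomial ring as well as in a field.  Here [m] and [n] are the
    derivatives of the two resolvent cubics at [alpha] and [beta]. *)
Section NormalForm.
Variables (R : comNzRingType) (x y a0 a2 a4 b2 b4 : R).

Let m := 12%:R * x ^+ 2 + a0.
Let n := 12%:R * y ^+ 2 + a4.
Let k := 2%:R * m * y + 2%:R * a2 * x + b2.
Let l := 2%:R * n * x + 2%:R * a2 * y + b4.
Let c := 24%:R * x * y + a2.

(** The genus-one fibration [w^2 = q(u)] over the s-line, as a polynomial in [u]. *)
Definition fibre_quartic : {poly {poly R}} :=
  Poly [:: m%:P * 'X; (6%:R * x)%:P * 'X^2 + k%:P; 'X^3 + c%:P * 'X;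
           (6%:R * y)%:P * 'X^2 + l%:P; n%:P * 'X].

Let w := 18%:R * x * y.
Let v := y * k + x * l.

(** In order: F4, G8, H8, G12, H12, H16.  They come from solving the identities of
    [fibre_jacobian_linear] and [fibre_jacobian_constant] for the coefficients. *)
Definition normal_form : seq R :=
  [:: c - 3%:R * w;
      3%:R * w ^+ 2 - 2%:R * w * c - 4%:R * m * n + 6%:R * v;
      - 4%:R * (9%:R * x ^+ 2 - m) * (9%:R * y ^+ 2 - n);
      k * l;
      (c - w) * (w ^+ 2 - 4%:R * m * n) - 6%:R * w * v
        + 12%:R * (n * x * k + m * y * l);
      n * k ^+ 2 + m * l ^+ 2 - w * k * l].

End NormalForm.

Lemma map_normal_form (R S : comNzRingType) (f : {rmorphism R -> S})
    (x y a0 a2 a4 b2 b4 : R) :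
  map f (normal_form x y a0 a2 a4 b2 b4) =
  normal_form (f x) (f y) (f a0) (f a2) (f a4) (f b2) (f b4).
Proof. rewrite /normal_form /=; congr [:: _; _; _; _; _; _]; ring. Qed.

(** The data are bigraded by the degrees in the two blocks of points: [x] has
    weight (1, 0), [a2] weight (1, 1), [b2] weight (2, 1), and so on.  Each
    coefficient has a balanced weight (w, w). *)
Lemma normal_form_scale (R : comNzRingType) (p q x y a0 a2 a4 b2 b4 : R) i :
  (normal_form (p * x) (q * y) (p ^+ 2 * a0) (p * q * a2) (q ^+ 2 * a4)
     (p ^+ 2 * q * b2) (p * q ^+ 2 * b4))`_i =
  (p * q) ^+ nth 0%N [:: 1; 2; 2; 3; 3; 4]%N i *
    (normal_form x y a0 a2 a4 b2 b4)`_i.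
Proof.
case: i => [|[|[|[|[|[|i]]]]]] /=; last by rewrite nth_nil mulr0.
all: ring.
Qed.

(** The normal form as a function of the points.  The argument [sixth] stands for
    1/6: then [alpha / 2 = r / 6], [a = - I / 3 = - 12 (1/6)^2 I] and
    [b = - J / 27 = - 8 (1/6)^3 J], where the last 8 becomes 4 because of the
    factor 2 in [polar_J2].  Taking 1/6 as an argument lets the same definition
    produce both the numbers attached to a configuration and the universal
    polynomials. *)
Definition invariants (R : comNzRingType) (sixth : R) (lam : 'I_8 -> R) : seq R :=
  let p := quartic (lam (pt 1)) (lam (pt 2)) (lam (pt 3)) (lam (pt 4)) in
  let q := quartic (lam (pt 5)) (lam (pt 6)) (lam (pt 7)) (lam (pt 8)) in
  normal_form
    (sixth * resolvent (lam (pt 1)) (lam (pt 2)) (lam (pt 3)) (lam (pt 4)))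
    (sixth * resolvent (lam (pt 5)) (lam (pt 6)) (lam (pt 7)) (lam (pt 8)))
    (- 12%:R * sixth ^+ 2 * quartic_I p) (- 12%:R * sixth ^+ 2 * polar_I p q)
    (- 12%:R * sixth ^+ 2 * quartic_I q)
    (- 4%:R * sixth ^+ 3 * polar_J2 p q) (- 4%:R * sixth ^+ 3 * polar_J2 q p).

Section Map.
Variables (R S : comNzRingType) (f : {rmorphism R -> S}).
Implicit Types p q : {poly R}.

Lemma quartic_I_map p : quartic_I (map_poly f p) = f (quartic_I p).
Proof. by rewrite !quartic_IE !coef_map; ring. Qed.

Lemma quartic_J_map p : quartic_J (map_poly f p) = f (quartic_J p).
Proof. by rewrite !quartic_JE !coef_map; ring. Qed.

Lemma polar_I_map p q : polar_I (map_poly f p) (map_poly f q) = f (polar_I p q).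
Proof. by rewrite /polar_I -rmorphD !quartic_I_map !rmorphB. Qed.

Lemma polar_J2_map p q :
  polar_J2 (map_poly f p) (map_poly f q) = f (polar_J2 p q).
Proof.
rewrite /polar_J2 -rmorphD -rmorphB !quartic_J_map; ring.
Qed.

Lemma quartic_map x y z t :
  map_poly f (quartic x y z t) = quartic (f x) (f y) (f z) (f t).
Proof. by rewrite /quartic !rmorphM !rmorphB /= !map_polyX !map_polyC. Qed.

Lemma map_invariants sixth lam :
  map f (invariants sixth lam) = invariants (f sixth) (fun i => f (lam i)).
Proof.
rewrite /invariants map_normal_form -!quartic_map !quartic_I_map polar_I_map.
rewrite !polar_J2_map /resolvent; congr normal_form; ring.
Qed.

End Map.

(** * The data of the construction in terms of the points *)

Section BigBlocks.
Variables (T : Type) (idx : T) (op : Monoid.com_law idx).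
Implicit Type F : 'I_8 -> T.

Lemma big_S_zero F : \big[op/idx]_(j in S_zero) F j =
  \big[op/idx]_(j <- [:: pt 1; pt 2; pt 3; pt 4]) F j.
Proof.
rewrite big_uniq //; apply: eq_bigl => j.
by rewrite !inE -!orbA.
Qed.

Lemma big_S_infty F : \big[op/idx]_(j in S_infty) F j =
  \big[op/idx]_(j <- [:: pt 5; pt 6; pt 7; pt 8]) F j.
Proof.
rewrite big_uniq //; apply: eq_bigl => j.
by rewrite !inE -!orbA.
Qed.

End BigBlocks.

Section Coef.
Variables (C : numFieldType) (lam : 'I_8 -> C).

Lemma b1E : b1 lam = quartic (lam (pt 1)) (lam (pt 2)) (lam (pt 3)) (lam (pt 4)).
Proof. by rewrite /b1 big_S_zero !big_cons big_nil /= mulr1 !mulrA. Qed.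

Lemma b2E : b2 lam = quartic (lam (pt 5)) (lam (pt 6)) (lam (pt 7)) (lam (pt 8)).
Proof. by rewrite /b2 big_S_infty !big_cons big_nil /= mulr1 !mulrA. Qed.

Lemma alphaE : alpha lam =
  resolvent (lam (pt 1)) (lam (pt 2)) (lam (pt 3)) (lam (pt 4)) / 3%:R.
Proof.
rewrite /alpha /e2 big_S_zero !big_cons big_nil /= !big_mkcondr /=.
by rewrite !big_S_zero !big_cons !big_nil /= /resolvent; field.
Qed.

Lemma betaE : beta lam =
  resolvent (lam (pt 5)) (lam (pt 6)) (lam (pt 7)) (lam (pt 8)) / 3%:R.
Proof.
rewrite /beta /e2 big_S_infty !big_cons big_nil /= !big_mkcondr /=.
by rewrite !big_S_infty !big_cons !big_nil /= /resolvent; field.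
Qed.

Lemma Q_tu_coef i : (Q_tu lam)`_i = ((b1 lam)`_i)%:P + ((b2 lam)`_i)%:P * 'X^2.
Proof. by rewrite /Q_tu coefD coefCM !coef_map mulrC. Qed.

Lemma I_Q : quartic_I (Q_tu lam) =
  (quartic_I (b1 lam))%:P + (polar_I (b1 lam) (b2 lam))%:P * 'X^2
  + (quartic_I (b2 lam))%:P * 'X^4.
Proof. rewrite /polar_I !quartic_IE !Q_tu_coef !coefD; ring. Qed.

Lemma J_Q : quartic_J (Q_tu lam) =
  (quartic_J (b1 lam))%:P + (polar_J2 (b1 lam) (b2 lam) / 2%:R)%:P * 'X^2
  + (polar_J2 (b2 lam) (b1 lam) / 2%:R)%:P * 'X^4
  + (quartic_J (b2 lam))%:P * 'X^6.
Proof.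
have half r : (2%:R * r) / 2%:R = r :> C by rewrite mulrC mulKf ?pnatr_eq0.
rewrite !polar_J2E !half !quartic_JE !Q_tu_coef /=; ring.
Qed.

End Coef.

(** * The two-neighbor quartic and its relative Jacobian *)

Lemma natr_poly_neq0 (C : numFieldType) k : k.+1%:R != 0 :> {poly C}.
Proof. by rewrite -polyC_natr polyC_eq0 pnatr_eq0. Qed.

Section FibreJacobian.
Variables (R : comNzRingType) (x y a0 a2 a4 b2 b4 : R).
Let q := fibre_quartic x y a0 a2 a4 b2 b4.
Let nf := normal_form x y a0 a2 a4 b2 b4.

Let W : {poly R} := 'X^3 + (nf`_0)%:P * 'X.

(** If [W = 3 T], the coefficient of [x] in the translated Jacobian
    [(x + T)^3 - (I / 3) (x + T) - J / 27] is [(W^2 - I) / 3].  The choice of F4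
    in [W] kills the term in [s^4]. *)
Lemma fibre_jacobian_linear :
  W ^+ 2 - quartic_I q = 3%:R * ((nf`_1)%:P * 'X^2 + (nf`_3)%:P).
Proof. rewrite /W quartic_IE !coef_Poly /nf /=; ring. Qed.

(** The constant coefficient of the same translated cubic, multiplied by 27.
    The terms in [s^9] and [s^7] cancel identically. *)
Lemma fibre_jacobian_constant :
  W ^+ 3 - 3%:R * quartic_I q * W - quartic_J q =
  27%:R * ((nf`_2)%:P * 'X^5 + (nf`_4)%:P * 'X^3 + (nf`_5)%:P * 'X).
Proof. rewrite /W quartic_IE quartic_JE !coef_Poly /nf /=; ring. Qed.

(** The relative Jacobian at [x = u X], divided by [u^3].  The two hypotheses say
    that the coefficients of [u^0] and [u^6] vanish; this is where the choice of
    roots [alpha], [beta] makes the result [u] times a quartic. *)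
Lemma two_neighbor_substitution (b0 b6 : R) :
  (2%:R * x) ^+ 3 + a0 * (2%:R * x) + b0 = 0 ->
  (2%:R * y) ^+ 3 + a4 * (2%:R * y) + b6 = 0 ->
  let X := (2%:R * x)%:P%:P + ('X)%:P * 'X + (2%:R * y)%:P%:P * 'X^2
    : {poly {poly R}} in
  X ^+ 3
    + (a0%:P%:P + a2%:P%:P * 'X^2 + a4%:P%:P * 'X^4) * X
    + (b0%:P%:P + b2%:P%:P * 'X^2 + b4%:P%:P * 'X^4 + b6%:P%:P * 'X^6)
  = 'X * q.
Proof.
move=> /(canRL (addKr _)) -> /(canRL (addKr _)) ->.
rewrite /q /fibre_quartic /= !cons_poly_def; ring.
Qed.

End FibreJacobian.

Section Cubics.
Variable R : comNzRingType.
Implicit Types u v w T : R.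

Lemma depressed_cubic_shift u v T :
  ('X^3 - u%:P * 'X - v%:P) \Po ('X + T%:P) =
  'X^3 + (3%:R * T)%:P * 'X^2 + (3%:R * T ^+ 2 - u)%:P * 'X
    + (T ^+ 3 - u * T - v)%:P.
Proof.
rewrite !comp_polyB comp_Xn_poly comp_polyM !comp_polyC comp_polyX; ring.
Qed.

Lemma monic_cubic_inj u v w u' v' w' :
  'X^3 + u%:P * 'X^2 + v%:P * 'X + w%:P
    = 'X^3 + u'%:P * 'X^2 + v'%:P * 'X + w'%:P ->
  [/\ u = u', v = v' & w = w'].
Proof.
have cubicE (a b c : R) : 'X^3 + a%:P * 'X^2 + b%:P * 'X + c%:P = Poly [:: c; b; a; 1].
  rewrite /= !cons_poly_def mul0r; ring.
rewrite !cubicE => E; split.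
- by move: (congr1 (fun p : {poly R} => p`_2) E); rewrite !coef_Poly.
- by move: (congr1 (fun p : {poly R} => p`_1) E); rewrite !coef_Poly.
- by move: (congr1 (fun p : {poly R} => p`_0) E); rewrite !coef_Poly.
Qed.

End Cubics.

Section Characterization.
Variables (C : numFieldType) (lam : 'I_8 -> C).

Let x := alpha lam / 2%:R.
Let y := beta lam / 2%:R.
Let a := a_coef lam.
Let b := b_coef lam.
Let q0 := fibre_quartic x y (a 0) (a 2) (a 4) (b 2) (b 4).
Let nf := normal_form x y (a 0) (a 2) (a 4) (b 2) (b 4).

Lemma alpha_root : alpha lam ^+ 3 + a 0 * alpha lam + b 0 = 0.
Proof.
rewrite /a /b /a_coef /b_coef I_Q J_Q !coefD !coefCM !coefXn !coefC /=.
rewrite !mulr0 !addr0 alphaE b1E.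
have := resolvent_root (lam (pt 1)) (lam (pt 2)) (lam (pt 3)) (lam (pt 4)).
move/(canRL (subrK _)) => E; apply: (mulfI (x := 27%:R)); rewrite ?pnatr_eq0 //.
move: (resolvent _ _ _ _) (quartic_I _) (quartic_J _) E => r i j.
by rewrite mulr0 add0r => <-; field.
Qed.

Lemma beta_root : beta lam ^+ 3 + a 4 * beta lam + b 6 = 0.
Proof.
rewrite /a /b /a_coef /b_coef I_Q J_Q !coefD !coefCM !coefXn !coefC /=.
rewrite !mulr0 !add0r mulr1 betaE b2E.
have := resolvent_root (lam (pt 5)) (lam (pt 6)) (lam (pt 7)) (lam (pt 8)).
move/(canRL (subrK _)) => E; apply: (mulfI (x := 27%:R)); rewrite ?pnatr_eq0 //.
move: (resolvent _ _ _ _) (quartic_I _) (quartic_J _) E => r i j.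
by rewrite mulr0 add0r => <-; field.
Qed.

(** Uniqueness holds because [u^4] can be cancelled. *)
Lemma two_neighbor_quarticE q : two_neighbor_quartic lam q <-> q = q0.
Proof.
have size_q0 : (size q0 <= 5)%N by apply: leq_trans (size_Poly _) _.
have E0 : ('X^2) ^+ 2 * q0 = x_subst lam ^+ 3
     + map_poly polyC (jac_A lam) * x_subst lam + map_poly polyC (jac_B lam).
  have X2 : 2%:R * x = alpha lam by rewrite /x mulrC divfK ?pnatr_eq0.
  have Y2 : 2%:R * y = beta lam by rewrite /y mulrC divfK ?pnatr_eq0.
  have := @two_neighbor_substitution _ x y (a 0) (a 2) (a 4) (b 2) (b 4) (b 0) (b 6).
  rewrite X2 Y2 => /(_ alpha_root beta_root) /=.
  rewrite -/q0 /x_subst /jac_A /jac_B => E.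
  transitivity ('X^3 * ('X * q0)); first ring.
  rewrite -E !rmorphM !rmorphD /= !rmorphM /= !map_polyC !map_polyX /=.
  rewrite -/(a 0) -/(a 2) -/(a 4) -/(b 0) -/(b 2) -/(b 4) -/(b 6); ring.
split=> [[_ E]|->]; last by split.
by apply: (mulfI (x := ('X^2) ^+ 2)); rewrite ?E ?E0 // !expf_neq0 // polyX_eq0.
Qed.

(** Comparing the coefficients of [x^2], [x] and 1, the translation and the six
    coefficients satisfy [3 T = s^3 + F4 s] and two polynomial equations in [s].
    The coefficient of [s^4] in the first determines F4, and then the two
    identities on the fibre quartic give the rest. *)
Lemma gaussian_coefficientsE f4 g8 h8 g12 h12 h16 :
  gaussian_coefficients lam f4 g8 h8 g12 h12 h16 <->
  [:: f4; g8; h8; g12; h12; h16] = nf.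
Proof.
have third i : 3%:R * ((3%:R)^-1 *: i) = i :> {poly C}.
  by rewrite -scalerAr mulr_natl -scaler_nat scalerA mulVf ?scale1r ?pnatr_eq0.
have twenty_seventh i : 27%:R * ((27%:R)^-1 *: i) = i :> {poly C}.
  by rewrite -scalerAr mulr_natl -scaler_nat scalerA mulVf ?scale1r ?pnatr_eq0.
have linear := fibre_jacobian_linear x y (a 0) (a 2) (a 4) (b 2) (b 4).
have const := fibre_jacobian_constant x y (a 0) (a 2) (a 4) (b 2) (b 4).
rewrite -/nf -/q0 in linear const.
split=> [[q [T [/two_neighbor_quarticE-> ]]]|nfE].
  rewrite /relative_jacobian depressed_cubic_shift => /monic_cubic_inj[E2 E1 E0].
  (* Clear denominators, to bring the equations to the shape of the identities. *)
  have {}E1 : (3%:R * T) ^+ 2 - quartic_I q0 = 3%:R * (g8%:P * 'X^2 + g12%:P).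
    rewrite -E1 mulrBr third; ring.
  have {}E0 : (3%:R * T) ^+ 3 - 3%:R * quartic_I q0 * (3%:R * T) - quartic_J q0
     = 27%:R * (h8%:P * 'X^5 + h12%:P * 'X^3 + h16%:P * 'X).
    rewrite -E0 -[in LHS](third (quartic_I q0)) -[in LHS](twenty_seventh (quartic_J q0)).
    ring.
  rewrite E2 in E1 E0.
  (* E1 and its instance for the normal form differ in degree 4 by 2 (f4 - F4). *)
  have Ef4 : f4 = nf`_0.
    have := congr2 (fun p q : {poly C} => p - q) E1 linear.
    set f := nf`_0; set g := nf`_1; set h := nf`_3.
    have -> : ('X^3 + f4%:P * 'X) ^+ 2 - quartic_I q0
          - (('X^3 + f%:P * 'X) ^+ 2 - quartic_I q0)
        = (2%:R * (f4 - f))%:P * 'X^4 + (f4 ^+ 2 - f ^+ 2)%:P * 'X^2 by ring.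
    have -> : 3%:R * (g8%:P * 'X^2 + g12%:P) - 3%:R * (g%:P * 'X^2 + h%:P)
        = (3%:R * (g8 - g))%:P * 'X^2 + (3%:R * (g12 - h))%:P by ring.
    move/(congr1 (fun p : {poly C} => p`_4)).
    rewrite !(coefD, coefCM, coefXn, coefC) /= !mulr0 !mulr1 !addr0.
    by move/eqP; rewrite mulf_eq0 pnatr_eq0 subr_eq0 => /eqP.
  rewrite Ef4 linear in E1; rewrite Ef4 const in E0.
  have {}E1 := mulfI (natr_poly_neq0 C 2) E1.
  have {}E0 := mulfI (natr_poly_neq0 C 26) E0.
  have coef k (r r' : {poly C}) : r = r' -> r`_k = r'`_k by move->.
  rewrite Ef4; congr [:: _; _; _; _; _; _].
  - by have := coef 2 _ _ E1; rewrite !(coefD, coefCM, coefXn, coefC) /= !mulr1 !addr0.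
  - have := coef 5%N _ _ E0.
    by rewrite !(coefD, coefCM, coefXn, coefC, coefX) /= !mulr0 !mulr1 !addr0.
  - by have := coef 0 _ _ E1; rewrite !(coefD, coefCM, coefXn, coefC) /= !mulr0 !add0r.
  - have := coef 3 _ _ E0.
    by rewrite !(coefD, coefCM, coefXn, coefC, coefX) /= !mulr0 !mulr1 !addr0 !add0r.
  have := coef 1 _ _ E0.
  by rewrite !(coefD, coefCM, coefXn, coefC, coefX) /= !mulr0 !mulr1 !add0r.
exists q0, ((3%:R)^-1 *: ('X^3 + f4%:P * 'X)); split; first exact/two_neighbor_quarticE.
set T := _ *: (_ + _).
have T3 : 3%:R * T = 'X^3 + (nf`_0)%:P * 'X by rewrite third -nfE.
rewrite -T3 -nfE /= in linear const.
rewrite /relative_jacobian depressed_cubic_shift /gaussian_normal_form.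
congr (_ + _%:P * _ + _%:P * _ + _%:P); first by rewrite T3 -nfE.
- apply: (mulfI (natr_poly_neq0 C 2)); rewrite -linear mulrBr third; ring.
apply: (mulfI (natr_poly_neq0 C 26)); rewrite -const.
rewrite -[in RHS](third (quartic_I q0)) -[in RHS](twenty_seventh (quartic_J q0)); ring.
Qed.

End Characterization.

(** * The universal coefficients *)

Lemma normal_form_invariants (C : numFieldType) (lam : 'I_8 -> C) :
  normal_form (alpha lam / 2%:R) (beta lam / 2%:R)
    (a_coef lam 0) (a_coef lam 2) (a_coef lam 4) (b_coef lam 2) (b_coef lam 4) =
  invariants (6%:R)^-1 lam.
Proof.
rewrite /a_coef /b_coef I_Q J_Q !coefD !coefCM !coefXn !coefC /=.
rewrite !mulr0 !mulr1 !addr0 !add0r alphaE betaE b1E b2E.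
by rewrite /invariants; congr normal_form; field.
Qed.

Definition universal_invariants (C : fieldType) : seq {mpoly C[8]} :=
  invariants ((6%:R)^-1)%:MP (fun i => 'X_i).

Lemma universal_invariantsE (C : fieldType) (lam : 'I_8 -> C) i :
  ((universal_invariants C)`_i).@[lam] = (invariants (6%:R)^-1 lam)`_i.
Proof.
have -> : invariants (6%:R)^-1 lam = map (meval lam) (universal_invariants C).
  by rewrite map_invariants /invariants /= mevalC !mevalXU.
have [lt_i|le_i] := ltnP i (size (universal_invariants C)).
  by rewrite (nth_map 0).
by rewrite !nth_default ?size_map // meval0.
Qed.

(** * Degrees *)

Section Homogeneity.
Variable C : numFieldType.
Implicit Types (p q : {mpoly C[8]}) (P Q : {poly {mpoly C[8]}}).

(** A propositional copy of homogeneity, whose closure lemmas can be selected by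
    the syntactic shape of the polynomial. *)
Definition homogeneous d p : Prop := p \is d.-homog.

Lemma hom_add d p q : homogeneous d p -> homogeneous d q -> homogeneous d (p + q).
Proof. exact: rpredD. Qed.
Lemma hom_opp d p : homogeneous d p -> homogeneous d (- p).
Proof. by rewrite /homogeneous rpredN. Qed.
Lemma hom_nat k d p : homogeneous d p -> homogeneous d (k%:R * p).
Proof. by rewrite /homogeneous mulr_natl; apply: rpredMn. Qed.
Lemma hom_Nnat k d p : homogeneous d p -> homogeneous d (- k%:R * p).
Proof. by rewrite mulNr => h; apply/hom_opp/hom_nat. Qed.
Lemma hom_mul a b d p q :
  homogeneous a p -> homogeneous b q -> (a + b)%N = d -> homogeneous d (p * q).
Proof. by move=> hp hq <-; apply: dhomogM. Qed.
Lemma hom_exp k a d p :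
  homogeneous a p -> (a * k)%N = d -> homogeneous d (p ^+ k).
Proof. by move=> hp <-; apply: dhomogMn. Qed.

(** Degrees of the factors of a product are found from the atoms, and only then
    compared with the expected total. *)
Ltac grade :=
  match goal with
  | h : homogeneous _ ?p |- homogeneous _ ?p => exact: h
  | |- homogeneous _ (_ + _) => apply: hom_add; grade
  | |- homogeneous _ (- _) => apply: hom_opp; grade
  | |- homogeneous _ (_%:R * _) => apply: hom_nat; grade
  | |- homogeneous _ (- _%:R * _) => apply: hom_Nnat; grade
  | |- homogeneous _ (_ * _) =>
      eapply hom_mul; [grade | grade | reflexivity]
  | |- homogeneous _ (_ ^+ _) => eapply hom_exp; [grade | reflexivity]
  end.

Lemma normal_form_homogeneous (x y a0 a2 a4 b2 b4 : {mpoly C[8]}) i :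
  homogeneous 2 x -> homogeneous 2 y ->
  homogeneous 4 a0 -> homogeneous 4 a2 -> homogeneous 4 a4 ->
  homogeneous 6 b2 -> homogeneous 6 b4 -> (i < 6)%N ->
  homogeneous (nth 0%N [:: 4; 8; 8; 12; 12; 16]%N i)
    (normal_form x y a0 a2 a4 b2 b4)`_i.
Proof.
move=> hx hy ha0 ha2 ha4 hb2 hb4.
by case: i => [|[|[|[|[|[|i]]]]]] //= _; grade.
Qed.

(** The degrees of the coefficients of a monic quartic as functions of its roots.
    This condition is additive, so it passes through the polarizations. *)
Definition graded P := forall k, (k <= 4)%N -> homogeneous (4 - k) P`_k.

Lemma graded_add P Q : graded P -> graded Q -> graded (P + Q).
Proof. by move=> hP hQ k le_k; rewrite coefD; apply: hom_add; auto. Qed.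

Lemma graded_sub P Q : graded P -> graded Q -> graded (P - Q).
Proof.
by move=> hP hQ k le_k; rewrite coefB; apply/hom_add/hom_opp; auto.
Qed.

Lemma graded_quartic p q r s :
  homogeneous 1 p -> homogeneous 1 q -> homogeneous 1 r -> homogeneous 1 s ->
  graded (quartic p q r s).
Proof.
move=> hp hq hr hs k le_k; rewrite quarticE coef_Poly.
have h1 : homogeneous 0 (1 : {mpoly C[8]}) by apply: dhomog1.
by case: k le_k => [|[|[|[|[|k]]]]] //= _; grade.
Qed.

Lemma quartic_I_homogeneous P : graded P -> homogeneous 4 (quartic_I P).
Proof.
move=> hP; rewrite quartic_IE.
move: (hP 0%N isT) (hP 1%N isT) (hP 2%N isT) (hP 3%N isT) (hP 4%N isT) => h0 h1 h2 h3 h4.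
grade.
Qed.

Lemma quartic_J_homogeneous P : graded P -> homogeneous 6 (quartic_J P).
Proof.
move=> hP; rewrite quartic_JE.
move: (hP 0%N isT) (hP 1%N isT) (hP 2%N isT) (hP 3%N isT) (hP 4%N isT) => h0 h1 h2 h3 h4.
grade.
Qed.

Lemma universal_homogeneous i : (i < 6)%N ->
  homogeneous (nth 0%N [:: 4; 8; 8; 12; 12; 16]%N i) (universal_invariants C)`_i.
Proof.
have hX j : homogeneous 1 ('X_j : {mpoly C[8]}).
  by rewrite /homogeneous dhomogX /= mdeg1.
have hc : homogeneous 0 (((6%:R)^-1)%:MP : {mpoly C[8]}).
  by rewrite /homogeneous -[_%:MP]mulr1 mul_mpolyC dhomogZ // dhomog1.
have hres j k l m : homogeneous 2 (resolvent 'X_j 'X_k 'X_l 'X_m : {mpoly C[8]}).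
  rewrite /resolvent.
  move: (hX j) (hX k) (hX l) (hX m) => h1 h2 h3 h4.
  grade.
pose p : {poly {mpoly C[8]}} := quartic 'X_(pt 1) 'X_(pt 2) 'X_(pt 3) 'X_(pt 4).
pose q : {poly {mpoly C[8]}} := quartic 'X_(pt 5) 'X_(pt 6) 'X_(pt 7) 'X_(pt 8).
have hp : graded p by apply: graded_quartic.
have hq : graded q by apply: graded_quartic.
have hpI P Q : graded P -> graded Q -> homogeneous 4 (polar_I P Q).
  move=> hP hQ; have hPQ := graded_add hP hQ.
  by apply: hom_add; last apply/hom_opp; first apply/hom_add/hom_opp;
    exact: quartic_I_homogeneous.
have hpJ P Q : graded P -> graded Q -> homogeneous 6 (polar_J2 P Q).
  move=> hP hQ; have hPQ := graded_add hP hQ; have hPQ' := graded_sub hP hQ.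
  by apply: hom_add; last apply/hom_opp/hom_nat; first apply/hom_add/hom_opp;
    exact: quartic_J_homogeneous.
have hI2 := hpI _ _ hp hq.
have hJ2 := hpJ _ _ hp hq.
have hJ4 := hpJ _ _ hq hp.
have hIp := quartic_I_homogeneous hp.
have hIq := quartic_I_homogeneous hq.
have hr1 := hres (pt 1) (pt 2) (pt 3) (pt 4).
have hr2 := hres (pt 5) (pt 6) (pt 7) (pt 8).
rewrite /universal_invariants /invariants -/p -/q.
clearbody p q; move: (resolvent _ _ _ _) (resolvent _ _ _ _) hr1 hr2 => r1 r2 hr1 hr2.
by apply: normal_form_homogeneous; grade.
Qed.

Lemma total_degreeP d p (lam : 'I_8 -> C) :
  homogeneous d p -> p.@[lam] != 0 -> total_degree d p.
Proof.
move=> hp p_nz; split=> //; have {}p_nz : p != 0.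
  by apply: contraNneq p_nz => ->; rewrite meval0.
by rewrite -(mlead_deg p_nz) (dhomog_mf hp) // mlead_supp.
Qed.

End Homogeneity.

(** The configuration (0, 2, 0, 3; 1, 2, 1, 3) has coinciding points, which keeps
    the numbers small and is harmless for polynomials in the lambdas. *)
Lemma invariants_nonzero (C : numFieldType) i : (i < 6)%N ->
  exists lam : 'I_8 -> C, (invariants (6%:R)^-1 lam)`_i != 0.
Proof.
move=> lt_i.
exists (fun j => nth 0 [:: 0; 2%:R; 0; 3%:R; 1; 2%:R; 1; 3%:R] j).
rewrite /invariants /=.
have -> : quartic 0 2%:R 0 3%:R = Poly [:: 0; 0; 6%:R; - 5%:R; 1] :> {poly C}.
  rewrite quarticE; congr (Poly [:: _; _; _; _; _]); ring.
have -> : quartic 1 2%:R 1 3%:R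
    = Poly [:: 6%:R; - 17%:R; 17%:R; - 7%:R; 1] :> {poly C}.
  rewrite quarticE; congr (Poly [:: _; _; _; _; _]); ring.
set p := Poly _; set q := Poly _.
have -> : quartic_I p = 36%:R by rewrite quartic_IE !coef_Poly /=; ring.
have -> : quartic_I q = 4%:R by rewrite quartic_IE !coef_Poly /=; ring.
have -> : polar_I p q = 21%:R.
  by rewrite /polar_I !quartic_IE !(coefD, coef_Poly) /=; ring.
have -> : polar_J2 p q = - 1080%:R by rewrite polar_J2E !coef_Poly /=; ring.
have -> : polar_J2 q p = - 360%:R by rewrite polar_J2E !coef_Poly /=; ring.
have -> : resolvent 0 2%:R 0 3%:R = 6%:R :> C by rewrite /resolvent; ring.
have -> : resolvent 1 2%:R 1 3%:R = 2%:R :> C by rewrite /resolvent; ring.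
set nf := normal_form _ _ _ _ _ _ _.
have -> : nf = [:: - 17%:R; 120%:R; - 36%:R; 12%:R; - 324%:R; - 72%:R].
  by rewrite /nf /normal_form; congr [:: _; _; _; _; _; _]; field.
by case: i lt_i => [|[|[|[|[|[|i]]]]]] //= _; rewrite ?oppr_eq0 pnatr_eq0.
Qed.

(** * The coefficient H8 *)

Lemma bracket_affine (R : comNzRingType) (lam : 'I_8 -> R) i j :
  bracket (affine_lift lam) i j = lam j - lam i.
Proof. by rewrite bracketE !mxE /= mul1r mul1r. Qed.

(** By the formula of [normal_form] this entry is, up to a constant factor, the
    product of the discriminants of the two residual quadratics. *)
Lemma invariants_H8 (R : comNzRingType) (sixth : R) (lam : 'I_8 -> R) :
  (invariants sixth lam)`_2 =
    - (324%:R * sixth ^+ 4 * mu (affine_lift lam) ^+ 2).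
Proof.
rewrite /invariants /normal_form /mu !bracket_affine /=.
set r := resolvent _ _ _ _; set I := quartic_I _.
set r' := resolvent _ _ _ _; set I' := quartic_I _.
transitivity (- 36%:R * sixth ^+ 4 * (4%:R * I - r ^+ 2) * (4%:R * I' - r' ^+ 2)).
  ring.
rewrite !resolvent_discriminant; ring.
Qed.

Lemma universal_H8 (C : numFieldType) :
  (universal_invariants C)`_2 = - ((4%:R)^-1 *: mu (universal_lift C) ^+ 2).
Proof.
rewrite invariants_H8 -/(universal_lift C) -mul_mpolyC; congr (- (_ * _)).
rewrite -mpolyC_nat -rmorphXn -rmorphM /=; congr _%:MP.
by field.
Qed.

(** * Covariance under projective transformations *)

Section Moebius.
Variables (R : comNzRingType) (a b c d : R).
Implicit Types p q : {poly R}.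
Let delta := a * d - b * c.

(** The binary quartic [p] after the substitution [t := (a t + b) / (c t + d)],
    multiplied by [(c t + d)^4]: the sum over [i] of
    [p_i (a t + b)^i (c t + d)^(4 - i)], expanded. *)
Definition moebius p : {poly R} :=
  Poly [::
    p`_4 * b ^+ 4 + p`_3 * b ^+ 3 * d + p`_2 * b ^+ 2 * d ^+ 2
      + p`_1 * b * d ^+ 3 + p`_0 * d ^+ 4;
    4%:R * p`_4 * a * b ^+ 3 + p`_3 * (b ^+ 3 * c + 3%:R * a * b ^+ 2 * d)
      + 2%:R * p`_2 * (b ^+ 2 * c * d + a * b * d ^+ 2)
      + p`_1 * (3%:R * b * c * d ^+ 2 + a * d ^+ 3) + 4%:R * p`_0 * c * d ^+ 3;
    6%:R * p`_4 * a ^+ 2 * b ^+ 2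
      + 3%:R * p`_3 * (a * b ^+ 2 * c + a ^+ 2 * b * d)
      + p`_2 * (b ^+ 2 * c ^+ 2 + 4%:R * a * b * c * d + a ^+ 2 * d ^+ 2)
      + 3%:R * p`_1 * (b * c ^+ 2 * d + a * c * d ^+ 2)
      + 6%:R * p`_0 * c ^+ 2 * d ^+ 2;
    4%:R * p`_4 * a ^+ 3 * b + p`_3 * (3%:R * a ^+ 2 * b * c + a ^+ 3 * d)
      + 2%:R * p`_2 * (a * b * c ^+ 2 + a ^+ 2 * c * d)
      + p`_1 * (b * c ^+ 3 + 3%:R * a * c ^+ 2 * d) + 4%:R * p`_0 * c ^+ 3 * d;
    p`_4 * a ^+ 4 + p`_3 * a ^+ 3 * c + p`_2 * a ^+ 2 * c ^+ 2
      + p`_1 * a * c ^+ 3 + p`_0 * c ^+ 4].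

Lemma moebiusD p q : moebius (p + q) = moebius p + moebius q.
Proof.
apply/polyP=> k; rewrite coefD !coef_Poly.
by case: k => [|[|[|[|[|k]]]]] /=; rewrite ?nth_nil ?addr0 // !coefD; ring.
Qed.

Lemma moebiusB p q : moebius (p - q) = moebius p - moebius q.
Proof.
apply/polyP=> k; rewrite coefB !coef_Poly.
by case: k => [|[|[|[|[|k]]]]] /=; rewrite ?nth_nil ?subr0 // !coefB; ring.
Qed.

Lemma quartic_I_moebius p : quartic_I (moebius p) = delta ^+ 4 * quartic_I p.
Proof. rewrite !quartic_IE !coef_Poly /= /delta; ring. Qed.

Lemma quartic_J_moebius p : quartic_J (moebius p) = delta ^+ 6 * quartic_J p.
Proof. rewrite !quartic_JE !coef_Poly /= /delta; ring. Qed.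

Lemma polar_I_moebius p q :
  polar_I (moebius p) (moebius q) = delta ^+ 4 * polar_I p q.
Proof. by rewrite /polar_I -moebiusD !quartic_I_moebius -!mulrBr. Qed.

Lemma polar_J2_moebius p q :
  polar_J2 (moebius p) (moebius q) = delta ^+ 6 * polar_J2 p q.
Proof.
rewrite /polar_J2 -moebiusD -moebiusB !quartic_J_moebius; ring.
Qed.

Lemma moebius_quartic x y z t :
  moebius (quartic x y z t) =
  \prod_(r <- [:: x; y; z; t]) ((a - r * c)%:P * 'X + (b - r * d)%:P).
Proof.
rewrite !big_cons big_nil quarticE /moebius !coef_Poly /= !cons_poly_def mul0r; ring.
Qed.

End Moebius.

Section Scaling.
Variables (R : comNzRingType) (u v : R) (p q : {poly R}).

Lemma quartic_I_scale : quartic_I (u%:P * p) = u ^+ 2 * quartic_I p.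
Proof. by rewrite !quartic_IE !coefCM; ring. Qed.

Lemma polar_I_scale : polar_I (u%:P * p) (v%:P * q) = u * v * polar_I p q.
Proof. by rewrite /polar_I !quartic_IE !coefD !coefCM; ring. Qed.

Lemma polar_J2_scale :
  polar_J2 (u%:P * p) (v%:P * q) = u ^+ 2 * v * polar_J2 p q.
Proof. by rewrite !polar_J2E !coefCM; ring. Qed.

End Scaling.

(** The hypotheses below say that the lift [(1, lam' i)] is [c i] times the image
    of [(1, lam i)] under the matrix [g]. *)
Section ProjectiveCovariance.
Variables (R : comNzRingType) (g00 g01 g10 g11 : R) (c lam lam' : 'I_8 -> R).
Hypothesis denominator : forall i, c i * (g00 + g01 * lam i) = 1.
Hypothesis numerator : forall i, lam' i = c i * (g10 + g11 * lam i).
Let delta := g00 * g11 - g01 * g10.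

Lemma difference_covariant i j : lam' j - lam' i = c i * c j * delta * (lam j - lam i).
Proof.
rewrite -[lam' j]mulr1 -[lam' i]mulr1 -{1}(denominator i) -(denominator j).
rewrite !numerator /delta; ring.
Qed.

(** The roots move by [g], so the quartic is pulled back along the inverse of [g],
    which up to the determinant is the adjugate; the rescalings make the product
    monic again. *)
Lemma quartic_covariant i j k l :
  quartic (lam' i) (lam' j) (lam' k) (lam' l) =
  (c i * c j * c k * c l)%:P *
    moebius g00 (- g10) (- g01) g11 (quartic (lam i) (lam j) (lam k) (lam l)).
Proof.
have root_covariant m : 'X - (lam' m)%:P = (c m)%:P *
    ((g00 - lam m * - g01)%:P * 'X + (- g10 - lam m * g11)%:P).
  rewrite numerator -{1}['X]mul1r -polyC1 -(denominator m); ring.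
rewrite moebius_quartic !big_cons big_nil /quartic !root_covariant; ring.
Qed.

Lemma resolvent_covariant i j k l :
  resolvent (lam' i) (lam' j) (lam' k) (lam' l) =
  c i * c j * c k * c l * delta ^+ 2
    * resolvent (lam i) (lam j) (lam k) (lam l).
Proof.
(* As a combination of brackets, the resolvent is visibly a relative invariant. *)
have bracketed x y z t : resolvent x y z t =
    - ((z - x) * (t - y) + (t - x) * (z - y)) :> R by rewrite /resolvent; ring.
rewrite !bracketed !difference_covariant; ring.
Qed.

(** With [u], [v] the products of the rescalings over the two blocks, all data scale
    according to their bidegree in [u delta^2] and [v delta^2], so that
    [normal_form_scale] applies. *)
Lemma invariants_covariant sixth i :
  (invariants sixth lam')`_i =
  (c (pt 1) * c (pt 2) * c (pt 3) * c (pt 4)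
    * (c (pt 5) * c (pt 6) * c (pt 7) * c (pt 8)) * delta ^+ 4)
      ^+ nth 0%N [:: 1; 2; 2; 3; 3; 4]%N i * (invariants sixth lam)`_i.
Proof.
rewrite /invariants !resolvent_covariant !quartic_covariant.
set u := _ * c (pt 4); set v := _ * c (pt 8).
move: (quartic _ _ _ _) (quartic _ _ _ _) (resolvent _ _ _ _) (resolvent _ _ _ _).
move=> p q r r'.
rewrite !(quartic_I_scale, polar_I_scale, polar_J2_scale).
rewrite !(quartic_I_moebius, polar_I_moebius, polar_J2_moebius).
have -> : g00 * g11 - - g10 * - g01 = delta by rewrite /delta; ring.
have -> : u * v * delta ^+ 4 = (u * delta ^+ 2) * (v * delta ^+ 2) by ring.
rewrite -normal_form_scale; congr (_`_i); congr normal_form; ring.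
Qed.

Lemma mu_covariant :
  mu (affine_lift lam') =
  (c (pt 1) * c (pt 2) * c (pt 3) * c (pt 4)
    * (c (pt 5) * c (pt 6) * c (pt 7) * c (pt 8)) * delta ^+ 4)
      * mu (affine_lift lam).
Proof. rewrite /mu !bracket_affine !difference_covariant; ring. Qed.

End ProjectiveCovariance.

(** * Invariance under the stabilizer of the marking *)

Section MarkingInvariance.
Variables (C : numFieldType) (lam : 'I_8 -> C) (s : 'S_8).

Lemma big_stable_block (T : Type) (idx : T) (op : Monoid.com_law idx) (S : {set 'I_8}) F :
  s @: S = S -> \big[op/idx]_(j in S) F (s j) = \big[op/idx]_(j in S) F j.
Proof.
move=> sS; rewrite -[in RHS]sS big_imset //.
by move=> i j _ _; apply: perm_inj.
Qed.

(** Only the pairing as an unordered set of unordered pairs matters, so the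
    permutation may exchange the two pairs. *)
Lemma pairing_sum_perm (P : {set {set 'I_8}}) :
  [set s @: (p : {set 'I_8}) | p in P] = P ->
  \sum_(p in P) \prod_(i in p) lam (s i) = \sum_(p in P) \prod_(i in p) lam i.
Proof.
move=> sP; rewrite -[in RHS]sP big_imset /=; last first.
  by move=> p q _ _; apply/imset_inj/perm_inj.
by apply: eq_bigr => p _; rewrite big_imset //= => i j _ _; apply: perm_inj.
Qed.

End MarkingInvariance.

Section Marking.
Variables (C : numFieldType) (lam : 'I_8 -> C).

Lemma sum_pairs (i j k l : 'I_8) : i != j -> i != k -> i != l -> k != l ->
  \sum_(p in [set [set i; j]; [set k; l]]) \prod_(i in p) lam i =
  lam i * lam j + lam k * lam l.
Proof.
move=> ij ik il kl; rewrite big_setU1 ?inE /=; last first.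
  by apply/eqP => /setP/(_ i); rewrite !inE eqxx (negPf ik) (negPf il).
by rewrite big_set1 !big_setU1 ?inE //= !big_set1.
Qed.

(** In this form [alpha] visibly depends only on the block, through [b1], and on its
    pairing; the definition through [e2] uses the order of the labels. *)
Lemma alpha_pairing : alpha lam = (b1 lam)`_2 / 3%:R
  - \sum_(p in pairing_zero) \prod_(i in p) lam i.
Proof.
rewrite alphaE b1E sum_pairs // quarticE coef_Poly /= /resolvent.
by field.
Qed.

Lemma beta_pairing : beta lam = (b2 lam)`_2 / 3%:R
  - \sum_(p in pairing_infty) \prod_(i in p) lam i.
Proof.
rewrite betaE b2E sum_pairs // quarticE coef_Poly /= /resolvent.
by field.
Qed.

End Marking.

Lemma invariants_H_d0 (C : numFieldType) (lam : 'I_8 -> C) (s : 'S_8) :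
  s \in H_d0 -> invariants (6%:R)^-1 (lam \o s) = invariants (6%:R)^-1 lam.
Proof.
rewrite inE => /and4P[/eqP s0 /eqP s1 /eqP sp0 /eqP sp1].
have eb1 : b1 (lam \o s) = b1 lam.
  exact: (big_stable_block _ (fun j => 'X - (lam j)%:P)).
have eb2 : b2 (lam \o s) = b2 lam.
  exact: (big_stable_block _ (fun j => 'X - (lam j)%:P)).
have eQ : Q_tu (lam \o s) = Q_tu lam by rewrite /Q_tu eb1 eb2.
rewrite -!normal_form_invariants !alpha_pairing !beta_pairing eb1 eb2.
by rewrite !pairing_sum_perm // /a_coef /b_coef eQ.
Qed.

(** The action of [msym s] substitutes ['X_(s i)] for ['X_i]; evaluation at [lam]
    turns this into the permutation of the points. *)
Lemma mu_ker_eps (C : comNzRingType) (lam : 'I_8 -> C) (s : 'S_8) :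
  s \in ker_eps C -> mu (affine_lift (lam \o s)) = mu (affine_lift lam).
Proof.
rewrite inE => /andP[_ /eqP /(congr1 (meval lam))].
rewrite /mu !bracket_affine !msymM !msymB /=.
have sX i : msym s ('X_i : {mpoly C[8]}) = 'X_(s i) by rewrite /msym mmapX mmap1U.
by rewrite !sX !mevalM !mevalB !mevalXU.
Qed.

(** * The coefficients as polynomials and on the cover *)

Theorem proposition7p1 (C : numClosedFieldType) :
  exists F4 G8 H8 G12 H12 H16 : {mpoly C[8]},
  [/\ (forall (lam : 'I_8 -> C) (f4 g8 h8 g12 h12 h16 : C),
         gaussian_coefficients lam f4 g8 h8 g12 h12 h16 <->
         (f4, g8, h8, g12, h12, h16) =
         (F4.@[lam], G8.@[lam], H8.@[lam], G12.@[lam], H12.@[lam], H16.@[lam])),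
      [/\ total_degree 4 F4, total_degree 8 G8 & total_degree 8 H8] /\
      [/\ total_degree 12 G12, total_degree 12 H12 & total_degree 16 H16],
      (let v := universal_lift C in
       H8 = - ((4%:R)^-1 *: (bracket v (pt 1) (pt 2) ^+ 2 *
                             bracket v (pt 3) (pt 4) ^+ 2 *
                             bracket v (pt 5) (pt 6) ^+ 2 *
                             bracket v (pt 7) (pt 8) ^+ 2)) /\
       H8 = - ((4%:R)^-1 *: mu v ^+ 2)) &
      exists H4 : {mpoly C[8]},
      [/\ H4 = (2%:R)^-1 *: mu (universal_lift C),
          H8 = - H4 ^+ 2 &
          forall lam lam' : 'I_8 -> C,
            distinct_points (affine_lift lam) ->
            distinct_points (affine_lift lam') ->
            same_moduli_point (ker_eps C) (affine_lift lam) (affine_lift lam') ->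
            same_weighted_point [:: 4; 4; 8; 12; 12; 16]%N
              [:: F4.@[lam]; H4.@[lam]; G8.@[lam]; G12.@[lam]; H12.@[lam];
                  H16.@[lam]]
              [:: F4.@[lam']; H4.@[lam']; G8.@[lam']; G12.@[lam']; H12.@[lam'];
                  H16.@[lam']]]].
Proof.
pose U i := (universal_invariants C)`_i.
have evalU lam i : (U i).@[lam] = (invariants (6%:R)^-1 lam)`_i.
  exact: universal_invariantsE.
have degU i : (i < 6)%N ->
    total_degree (nth 0%N [:: 4; 8; 8; 12; 12; 16]%N i) (U i).
  move=> lt_i; have [lam nz] := invariants_nonzero C lt_i.
  apply: (total_degreeP (lam := lam)); first exact: universal_homogeneous.
  by rewrite evalU.
have H8E : U 2 = - ((4%:R)^-1 *: mu (universal_lift C) ^+ 2).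
  exact: universal_H8.
clearbody U; exists (U 0), (U 1), (U 2), (U 3), (U 4), (U 5).
split.
- move=> lam f4 g8 h8 g12 h12 h16; rewrite !evalU.
  apply: (iff_trans (gaussian_coefficientsE _ _ _ _ _ _ _)).
  rewrite normal_form_invariants.
  have : size (invariants (6%:R)^-1 lam) = 6%N by [].
  case: (invariants _ lam) => [|v0 [|v1 [|v2 [|v3 [|v4 [|v5 [|]]]]]]] //= _.
  by split=> [] [-> -> -> -> -> ->].
- by split; split; [exact: (degU 0%N)|exact: (degU 1)|exact: (degU 2)
    |exact: (degU 3)|exact: (degU 4)|exact: (degU 5%N)].
- have sqrM4 (x y z t : {mpoly C[8]}) :
      x ^+ 2 * y ^+ 2 * z ^+ 2 * t ^+ 2 = (x * y * z * t) ^+ 2 by ring.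
  by move=> v; rewrite sqrM4; split; exact: H8E.
exists ((2%:R)^-1 *: mu (universal_lift C)); split; first by [].
  by rewrite H8E exprZn exprVn -natrX.
move=> lam lam' _ _ [s [g [c [sG gU c_nz lift_eq]]]].
have sH : s \in H_d0 by move: sG; rewrite inE => /andP[].
have entry i k : affine_lift lam' i k 0 =
    c i * (g k 0 + g k 1 * (lam \o s) i).
  rewrite lift_eq !mxE !big_ord_recl big_ord0 !mxE /= mulr1 addr0.
  by congr (_ * (_ + g k _ * _)); apply/val_inj.
have den i : c i * (g 0 0 + g 0 1 * (lam \o s) i) = 1.
  by rewrite -entry mxE.
have num i : lam' i = c i * (g 1 0 + g 1 1 * (lam \o s) i).
  by rewrite -entry mxE.
have inv i := invariants_covariant den num (6%:R)^-1 i.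
have muE := mu_covariant den num.
(* rho = det(g)^4 times the product of the rescalings; the weights are all
   divisible by 4, so a fourth root of rho is what is needed. *)
set rho : C := _ * _ ^+ 4 in inv muE.
have rho_nz : rho != 0.
  by rewrite !mulf_neq0 ?expf_neq0 // -det_mx2 -unitfE -unitmxE.
pose r := 4.-root rho.
have r4 : r ^+ 4 = rho by apply: rootCK.
have mu_eval l : (mu (universal_lift C)).@[l] = mu (affine_lift l).
  by rewrite /mu !bracket_affine !mevalM !mevalB !mevalXU.
exists r; first by move: rho_nz; rewrite -r4 expf_eq0.
rewrite mu_ker_eps // in muE.
rewrite (invariants_H_d0 _ sH) -r4 in inv.
rewrite !mevalZ !mu_eval !evalU muE -r4.
move: (invariants _ lam) (invariants _ lam') inv => V V' inv.
case=> [|[|[|[|[|[|k]]]]]] //= _; rewrite ?inv -?exprM //.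
by rewrite mulrCA.
Qed.
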